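(* If $(\bar x,\bar y)\in\mathbb{R}^n\times\mathbb{R}^n$ is a CAKKT point for the relaxed problem (RP), then $(\bar x,\bar y)$ is $AW$-stationary for (RP).
   Context: Setting. Let $\alpha,n$ be natural numbers with $0<\alpha<n$, and let $f:\mathbb{R}^n\to\mathbb{R}$, $g:\mathbb{R}^n\to\mathbb{R}^m$, $h:\mathbb{R}^n\to\mathbb{R}^p$ be continuously differentiable. Let $e=(1,\ldots,1)\in\mathbb{R}^n$ and define $\theta(y)=n-\alpha-e^Ty\in\mathbb{R}$, $G(x)=x$, $H(y)=-y$, $\tilde H(y)=y-e$ for $x,y\in\mathbb{R}^n$. Let $*$ denote the componentwise (Hadamard) product; vector inequalities and the minimum $\min\{\cdot,\cdot\}$ of vectors are taken componentwise. The relaxed problem (RP) (a continuous reformulation of minimizing $f(x)$ subject to $g(x)\le 0$, $h(x)=0$ and $x$ having at most $\alpha$ nonzero components) is: minimize $f(x)$ over $(x,y)\in\mathbb{R}^n\times\mathbb{R}^n$ subject to $g(x)\le 0$, $h(x)=0$, $\theta(y)\le 0$, $H(y)\le 0$, $\tilde H(y)\le 0$, $G(x)*H(y)=0$. Definition (CAKKT). For a general nonlinear program: minimize $F(z)$ over $z\in\mathbb{R}^N$ subject to $a(z)\le 0$, $b(z)=0$, with $F:\mathbb{R}^N\to\mathbb{R}$, $a:\mathbb{R}^N\to\mathbb{R}^M$, $b:\mathbb{R}^N\to\mathbb{R}^P$ continuously differentiable, a feasible point $\bar z$ is a Complementary Approximate KKT (CAKKT) point if there exist sequences $(z^k)\subset\mathbb{R}^N$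 and $(\lambda^{a,k},\lambda^{b,k})\subset\mathbb{R}_+^M\times\mathbb{R}^P$ such that $z^k\to\bar z$, $\nabla F(z^k)+\sum_{i=1}^M\lambda_i^{a,k}\nabla a_i(z^k)+\sum_{j=1}^P\lambda_j^{b,k}\nabla b_j(z^k)\to 0$, $\lambda^{a,k}*a(z^k)\to 0$ and $\lambda^{b,k}*b(z^k)\to 0$. This definition is applied to (RP) with $z=(x,y)$, inequality constraints $g(x)\le 0$, $\theta(y)\le 0$, $H(y)\le 0$, $\tilde H(y)\le 0$, and equality constraints $h(x)=0$, $G(x)*H(y)=0$. Let $L(x,\lambda^g,\lambda^h)=f(x)+(\lambda^g)^Tg(x)+(\lambda^h)^Th(x)$ and, for $\lambda=(\lambda^g,\lambda^h,\lambda^\theta,\lambda^G,\lambda^H,\lambda^{\tilde H})$, let $$\mathcal{L}(x,y,\lambda)=L(x,\lambda^g,\lambda^h)+\lambda^\theta\theta(y)+(\lambda^G)^TG(x)+(\lambda^H)^TH(y)+(\lambda^{\tilde H})^T\tilde H(y).$$ Definition ($AW$-stationarity). A feasible point $(\bar x,\bar y)$ of (RP) is called $AW$-stationary (Approximately Weakly stationary) for (RP) if there exist sequences $(x^k,y^k)\subset\mathbb{R}^n\times\mathbb{R}^n$ and $\lambda^k=(\lambda^{g,k},\lambda^{h,k},\lambda^{\theta,k},\lambda^{G,k},\lambda^{H,k},\lambda^{\tilde H,k})\in\mathbb{R}_+^m\times\mathbb{R}^p\times\mathbb{R}_+\times\mathbb{R}^n\times\mathbb{R}^n\times\mathbb{R}_+^n$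 such that, as $k\to\infty$: (1) $(x^k,y^k)\to(\bar x,\bar y)$; (2) $\nabla_{x,y}\mathcal{L}(x^k,y^k,\lambda^k)\to 0$; (3) $\min\{-g(x^k),\lambda^{g,k}\}\to 0$; (4) $\min\{-\theta(y^k),\lambda^{\theta,k}\}\to 0$; (5) $\min\{|G_i(x^k)|,|\lambda_i^{G,k}|\}\to 0$ for all $i=1,\ldots,n$; (6) $\min\{-H_i(y^k),|\lambda_i^{H,k}|\}\to 0$ for all $i=1,\ldots,n$; (7) $\min\{-\tilde H(y^k),\lambda^{\tilde H,k}\}\to 0$. *)

(* Defs.v *)
From HB Require Import structures.
From mathcomp Require Import all_boot all_order all_algebra.
From mathcomp Require Import all_classical all_reals all_analysis.

Set Implicit Arguments.
Unset Strict Implicit.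
Unset Printing Implicit Defensive.

Import Order.TTheory GRing.Theory Num.Theory.
Import numFieldNormedType.Exports.

Local Open Scope classical_set_scope.
Local Open Scope ring_scope.

(* Vectors of R^n are row vectors 'rV[R]_n, and a pair (x, y) in R^n x R^n is
   the row vector row_mx x y : 'rV[R]_(n + n). *)

Definition dot {R : realType} {n : nat} (u v : 'rV[R]_n) : R :=
  \sum_(i < n) u 0 i * v 0 i.

Definition hadamard {R : realType} {n : nat} (u v : 'rV[R]_n) : 'rV[R]_n :=
  map2_mx *%R u v.

Definition minv {R : realType} {n : nat} (u v : 'rV[R]_n) : 'rV[R]_n :=
  map2_mx Num.min u v.

Definition nonneg {R : realType} {n : nat} (u : 'rV[R]_n) : Prop :=
  forall i, 0 <= u 0 i.

Definition nonpos {R : realType} {n : nat} (u : 'rV[R]_n) : Prop :=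
  forall i, u 0 i <= 0.

Definition grad {R : realType} {n : nat} (F : 'rV[R]_n -> R) (z : 'rV[R]_n) :
    'rV[R]_n :=
  \row_(j < n) 'D_(delta_mx 0 j) F z.

Definition C1 {R : realType} {n : nat} (F : 'rV[R]_n -> R) : Prop :=
  (forall z, differentiable F z) /\ continuous (grad F).

Definition C1v {R : realType} {n m : nat} (F : 'rV[R]_n -> 'rV[R]_m) : Prop :=
  (forall z, differentiable F z) /\ continuous (jacobian F).

Record nlp (R : realType) (N M P : nat) := Nlp {
  objective : 'rV[R]_N -> R ;
  ineq : 'rV[R]_N -> 'rV[R]_M ;
  eqc : 'rV[R]_N -> 'rV[R]_P
}.

Definition feasible {R : realType} {N M P : nat} (Q : nlp R N M P)
    (z : 'rV[R]_N) : Prop :=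
  nonpos (ineq Q z) /\ eqc Q z = 0.

Definition CAKKT {R : realType} {N M P : nat} (Q : nlp R N M P)
    (zbar : 'rV[R]_N) : Prop :=
  feasible Q zbar /\
  exists (z : nat -> 'rV[R]_N) (la : nat -> 'rV[R]_M) (lb : nat -> 'rV[R]_P),
    [/\ (forall k, nonneg (la k)),
        z k @[k --> \oo] --> zbar,
        (grad (objective Q) (z k)
         + \sum_(i < M) la k 0 i *: grad (fun u => ineq Q u 0 i) (z k)
         + \sum_(j < P) lb k 0 j *: grad (fun u => eqc Q u 0 j) (z k))
          @[k --> \oo] --> (0 : 'rV[R]_N),
        hadamard (la k) (ineq Q (z k)) @[k --> \oo] --> (0 : 'rV[R]_M)
      & hadamard (lb k) (eqc Q (z k)) @[k --> \oo] --> (0 : 'rV[R]_P)].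

Definition ones (R : realType) (n : nat) : 'rV[R]_n := const_mx 1.

Definition theta {R : realType} {n : nat} (alpha : nat) (y : 'rV[R]_n) : R :=
  n%:R - alpha%:R - dot (ones R n) y.

Definition Gmap {R : realType} {n : nat} (x : 'rV[R]_n) : 'rV[R]_n := x.

Definition Hmap {R : realType} {n : nat} (y : 'rV[R]_n) : 'rV[R]_n := - y.

Definition Htilde {R : realType} {n : nat} (y : 'rV[R]_n) : 'rV[R]_n :=
  y - ones R n.

Definition RP {R : realType} {n m p : nat} (alpha : nat) (f : 'rV[R]_n -> R)
    (g : 'rV[R]_n -> 'rV[R]_m) (h : 'rV[R]_n -> 'rV[R]_p) :
    nlp R (n + n) (m + (1 + (n + n))) (p + n) :=
  {| objective := fun z => f (lsubmx z) ;
     ineq := fun z =>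
       let x := lsubmx z in let y := rsubmx z in
       row_mx (g x)
         (row_mx (const_mx (theta alpha y) : 'rV[R]_1)
           (row_mx (Hmap y) (Htilde y))) ;
     eqc := fun z =>
       let x := lsubmx z in let y := rsubmx z in
       row_mx (h x) (hadamard (Gmap x) (Hmap y)) |}.

Definition Lag {R : realType} {n m p : nat} (f : 'rV[R]_n -> R)
    (g : 'rV[R]_n -> 'rV[R]_m) (h : 'rV[R]_n -> 'rV[R]_p) (x : 'rV[R]_n)
    (lg : 'rV[R]_m) (lh : 'rV[R]_p) : R :=
  f x + dot lg (g x) + dot lh (h x).

Definition LagRP {R : realType} {n m p : nat} (alpha : nat)
    (f : 'rV[R]_n -> R) (g : 'rV[R]_n -> 'rV[R]_m) (h : 'rV[R]_n -> 'rV[R]_p)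
    (x y : 'rV[R]_n) (lg : 'rV[R]_m) (lh : 'rV[R]_p) (lt : R)
    (lG lH lHt : 'rV[R]_n) : R :=
  Lag f g h x lg lh + lt * theta alpha y + dot lG (Gmap x) + dot lH (Hmap y)
  + dot lHt (Htilde y).

Definition AW_stationary {R : realType} {n m p : nat} (alpha : nat)
    (f : 'rV[R]_n -> R) (g : 'rV[R]_n -> 'rV[R]_m) (h : 'rV[R]_n -> 'rV[R]_p)
    (xbar ybar : 'rV[R]_n) : Prop :=
  feasible (RP alpha f g h) (row_mx xbar ybar) /\
  exists (x y : nat -> 'rV[R]_n) (lg : nat -> 'rV[R]_m)
      (lh : nat -> 'rV[R]_p) (lt : nat -> R) (lG lH lHt : nat -> 'rV[R]_n),
    (forall k, [/\ nonneg (lg k), 0 <= lt k & nonneg (lHt k)]) /\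
    [/\ row_mx (x k) (y k) @[k --> \oo] --> row_mx xbar ybar,
        grad (fun z => LagRP alpha f g h (lsubmx z) (rsubmx z)
                         (lg k) (lh k) (lt k) (lG k) (lH k) (lHt k))
             (row_mx (x k) (y k)) @[k --> \oo] --> (0 : 'rV[R]_(n + n)),
        minv (- g (x k)) (lg k) @[k --> \oo] --> (0 : 'rV[R]_m),
        Num.min (- theta alpha (y k)) (lt k) @[k --> \oo] --> (0 : R)
      & [/\ (forall i : 'I_n,
              Num.min `|Gmap (x k) 0 i| `|lG k 0 i| @[k --> \oo] --> (0 : R)),
            (forall i : 'I_n,
              Num.min (- Hmap (y k) 0 i) `|lH k 0 i| @[k --> \oo] --> (0 : R))
          & minv (- Htilde (y k)) (lHt k) @[k --> \oo] --> (0 : 'rV[R]_n)]].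

(* Main.v *)
Require Import Defs.
From HB Require Import structures.
From mathcomp Require Import all_boot all_order all_algebra.
From mathcomp Require Import all_classical all_reals all_analysis.
From mathcomp Require Import ring lra.

(** Given CAKKT multipliers, with [kappa] those of [G(x) * H(y) = 0], take
    [lG = kappa * H(y^k)] and [lH = lambda^H + kappa * x^k], keeping the other
    ones. The two Lagrangians then differ, up to a constant, by
    [sum_i kappa_i (x_i - x_i^k) (y_i - y_i^k)], whose gradient vanishes at
    [(x^k, y^k)]. The minima tend to 0 because the corresponding products do:
    [|min(a, l)| <= |a0 - a| + sqrt |a l|] whenever [a0, l >= 0]. *)

Set Implicit Arguments.
Unset Strict Implicit.
Unset Printing Implicit Defensive.

Import Order.TTheory GRing.Theory Num.Theory.
Import numFieldNormedType.Exports.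

(** * Convergence of minima from convergence of products *)

Section Convergence.
Local Open Scope classical_set_scope.
Local Open Scope ring_scope.

(** The matrix norm is a maximum over finitely many entries, so the eventual bounds on the entries
    hold simultaneously. *)
Lemma cvg_mx_coord (R : realType) (T : Type) (F : set_system T)
    {FF : Filter F} m n (u : T -> 'M[R]_(m, n)) (M : 'M[R]_(m, n)) :
  (forall i j, u t i j @[t --> F] --> M i j) -> u @ F --> M.
Proof.
move=> uM; apply/cvgrPdist_le => /= e e0; near=> t.
rewrite /Num.Def.normr/= mx_normrE (bigmax_le _ (ltW e0))//= => i _.
rewrite !mxE/=; move: i; near: t; apply: filter_forall => /= i.
exact: ((cvgrPdist_le _ _).1 (uM i.1 i.2)).
Unshelve. all: by end_near. Qed.

Lemma eq_fun_cvg (T : Type) (U : topologicalType) (F : set_system T)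
    (u v : T -> U) (l : U) : u =1 v -> u @ F --> l -> v @ F --> l.
Proof. by move=> /funext ->. Qed.

Lemma cvg_coord (R : realType) (T : Type) (F : set_system T)
    {FF : Filter F} m n (u : T -> 'M[R]_(m, n)) (M : 'M[R]_(m, n)) i j :
  u @ F --> M -> u t i j @[t --> F] --> M i j.
Proof.
move=> uM; exact: (continuous_cvg _ (@coord_continuous R m n i j M) uM).
Qed.

(** If [a >= 0], both factors of [a * l] dominate the minimum, so its square is at most [a * l]. If
    [a < 0], the minimum is [a] itself, and [a0 >= 0] makes its distance to [a0] at least [-a]. *)
Lemma norm_min_le (R : rcfType) (a0 a l : R) : 0 <= a0 -> 0 <= l ->
  `|Num.min a l| <= `|a0 - a| + Num.sqrt `|a * l|.
Proof.
move=> a00 l0; case: (leP 0 a) => [a_ge0|a_lt0].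
  have mge0 : 0 <= Num.min a l by rewrite le_min a_ge0.
  apply: (@le_trans _ _ (Num.sqrt `|a * l|)); last by rewrite lerDr.
  rewrite -sqrtr_sqr ler_sqrt// expr2 (ger0_norm (mulr_ge0 a_ge0 l0)).
  by apply: ler_pM => //; rewrite ge_min lexx ?orbT.
rewrite (min_l (le_trans (ltW a_lt0) l0)) ler_wpDr// ?sqrtr_ge0//.
rewrite (ltr0_norm a_lt0) ger0_norm ?subr_ge0.
  by rewrite lerDr.
exact: le_trans (ltW a_lt0) a00.
Qed.

(** Only the product is controlled, so [l] may be unbounded. As [a t] may be negative along the way,
    the squeeze is two-sided, between [- B] and [B]. *)
Lemma cvg_min0 (R : realType) (T : Type) (F : set_system T)
    {FF : Filter F} (a l : T -> R) (a0 : R) :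
  0 <= a0 -> (forall t, 0 <= l t) -> a @ F --> a0 ->
  `|a t * l t| @[t --> F] --> (0 : R) ->
  Num.min (a t) (l t) @[t --> F] --> (0 : R).
Proof.
move=> a00 l0 aF alF.
pose B t := `|a0 - a t| + Num.sqrt `|a t * l t|.
have B0 : B t @[t --> F] --> (0 : R).
  have aF0 : a0 - a t @[t --> F] --> a0 - a0.
    by apply: cvgB => //; exact: cvg_cst.
  have sF0 := continuous_cvg _ (@sqrt_continuous R _) alF.
  have /= := cvgD (cvg_norm aF0) (sF0 _).
  rewrite subrr normr0 sqrtr0 addr0; exact.
apply: (squeeze_cvgr (f := fun t => - B t) (h := B)) => //.
  by apply: nearW => t; rewrite -ler_norml norm_min_le.
by rewrite -oppr0; exact: cvgN.
Qed.

End Convergence.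

(** * Calculus rules for gradients *)

Section Gradients.
Local Open Scope classical_set_scope.
Local Open Scope ring_scope.
Variable R : realType.

Lemma dot_row_mx n1 n2 (a : 'rV[R]_(n1 + n2)) (c : 'rV[R]_n1) (d : 'rV[R]_n2) :
  dot a (row_mx c d) = dot (lsubmx a) c + dot (rsubmx a) d.
Proof.
by rewrite /dot big_split_ord /=; congr (_ + _); apply: eq_bigr => i _;
  rewrite ?row_mxEl ?row_mxEr mxE.
Qed.

Lemma differentiable_dot N M (a : 'rV[R]_M) (A : 'rV[R]_N -> 'rV[R]_M) z :
  (forall i, differentiable (fun u => A u 0 i) z) ->
  differentiable (fun u => dot a (A u)) z.
Proof.
move=> dA.
rewrite (_ : (fun _ => _) = \sum_(i < M) a 0 i *: (fun u => A u 0 i)).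
  by apply: differentiable_sum => i; exact: differentiableZ.
by apply/funext => u; rewrite fct_sumE.
Qed.

(** Serves to fold a multiplier-weighted sum of constraint gradients into the gradient of one
    function. *)
Lemma grad_dot N M (a : 'rV[R]_M) (A : 'rV[R]_N -> 'rV[R]_M) z :
  (forall i, differentiable (fun u => A u 0 i) z) ->
  grad (fun u => dot a (A u)) z =
    \sum_(i < M) a 0 i *: grad (fun u => A u 0 i) z.
Proof.
move=> dA; apply/rowP => j; rewrite mxE summxE.
rewrite (_ : (fun _ => _) = \sum_(i < M) a 0 i *: (fun u => A u 0 i)); last first.
  by apply/funext => u; rewrite fct_sumE.
rewrite derive_sum; last first.
  by move=> i; apply: derivableZ; exact: diff_derivable.
by apply: eq_bigr => i _; rewrite deriveZ ?mxE//; exact: diff_derivable.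
Qed.

Lemma gradD N (F G : 'rV[R]_N -> R) z :
  differentiable F z -> differentiable G z ->
  grad (F + G) z = grad F z + grad G z.
Proof.
move=> dF dG; apply/rowP => j; rewrite !mxE.
by rewrite deriveD//; exact: diff_derivable.
Qed.

(** Each term of the product rule keeps one undifferentiated factor. Meant for the products of
    increments around the current iterate. *)
Lemma grad_mul0 N (F G : 'rV[R]_N -> R) z :
  differentiable F z -> differentiable G z -> F z = 0 -> G z = 0 ->
  grad (F * G) z = 0.
Proof.
move=> dF dG F0 G0; apply/rowP => j; rewrite !mxE.
by rewrite deriveM ?F0 ?G0 ?scale0r ?addr0//; exact: diff_derivable.
Qed.

End Gradients.

(** * Constraints and Lagrangian of the relaxed problem *)

Section RelaxedProblem.
Local Open Scope classical_set_scope.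
Local Open Scope ring_scope.

(** By feasibility the limit of [- A (z k) 0 i] is nonnegative, so [cvg_min0] applies. This yields
    the conditions on [g], [theta] and [Htilde], whose multipliers are kept. *)
Lemma CAKKT_min (R : realType) N M (A : 'rV[R]_N -> 'rV[R]_M)
    (z : nat -> 'rV[R]_N) (la : nat -> 'rV[R]_M) zbar i :
  differentiable (fun u => A u 0 i) zbar ->
  A zbar 0 i <= 0 -> (forall k, nonneg (la k)) -> z @ \oo --> zbar ->
  hadamard (la k) (A (z k)) @[k --> \oo] --> (0 : 'rV[R]_M) ->
  Num.min (- A (z k) 0 i) (la k 0 i) @[k --> \oo] --> (0 : R).
Proof.
move=> dA A0 la0 zz /(cvg_coord (i := 0) (j := i)); rewrite mxE => h.
apply: (@cvg_min0 _ _ _ _ _ _ (- A zbar 0 i)).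
- by rewrite oppr_ge0.
- by move=> k; exact: la0.
- have Az := continuous_cvg _ (differentiable_continuous dA) zz.
  exact: (cvgN (Az _)).
- have h1 : `|hadamard (la k) (A (z k)) 0 i| @[k --> \oo] --> `|0 : R|.
    exact: cvg_norm.
  rewrite normr0 in h1; apply: eq_fun_cvg h1 => k.
  by rewrite mxE mulNr normrN mulrC.
Qed.

Lemma differentiable_lsubmx_coord (R : realType) n1 n2 (z : 'rV[R]_(n1 + n2)) i :
  differentiable (fun u : 'rV[R]_(n1 + n2) => lsubmx u 0 i) z.
Proof.
rewrite (_ : (fun _ => _) = (fun u : 'rV[R]_(n1 + n2) => u 0 (lshift n2 i))).
  exact: differentiable_coord.
by apply/funext => u; rewrite mxE.
Qed.

Lemma differentiable_rsubmx_coord (R : realType) n1 n2 (z : 'rV[R]_(n1 + n2)) i :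
  differentiable (fun u : 'rV[R]_(n1 + n2) => rsubmx u 0 i) z.
Proof.
rewrite (_ : (fun _ => _) = (fun u : 'rV[R]_(n1 + n2) => u 0 (rshift n1 i))).
  exact: differentiable_coord.
by apply/funext => u; rewrite mxE.
Qed.

Lemma differentiable_comp_lsubmx (R : realType) n1 n2 m (g : 'rV[R]_n1 -> 'rV[R]_m)
    (z : 'rV[R]_(n1 + n2)) i :
  (forall x, differentiable g x) ->
  differentiable (fun u : 'rV[R]_(n1 + n2) => g (lsubmx u) 0 i) z.
Proof.
move=> dg.
apply: (@differentiable_comp _ _ _ _ (fun u : 'rV[R]_(n1 + n2) => g (lsubmx u))
  (fun v : 'rV[R]_m => v 0 i)); last exact: differentiable_coord.
apply: (@differentiable_comp _ _ _ _ (lsubmx : 'rV[R]_(n1 + n2) -> _) g) => //.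
exact: differentiable_lsubmx.
Qed.

Lemma differentiable_row_mx (R : realType) N n1 n2 (A : 'rV[R]_N -> 'rV[R]_n1)
    (B : 'rV[R]_N -> 'rV[R]_n2) z :
  (forall i, differentiable (fun u => A u 0 i) z) ->
  (forall i, differentiable (fun u => B u 0 i) z) ->
  forall i, differentiable (fun u => row_mx (A u) (B u) 0 i) z.
Proof.
move=> dA dB i; case: (split_ordP i) => j ->.
  by under eq_fun do rewrite row_mxEl.
by under eq_fun do rewrite row_mxEr.
Qed.

Lemma differentiable_RP_ineq (R : realType) n m p alpha (f : 'rV[R]_n -> R)
    (g : 'rV[R]_n -> 'rV[R]_m) (h : 'rV[R]_n -> 'rV[R]_p) z :
  (forall x, differentiable g x) ->
  forall i, differentiable (fun u => ineq (RP alpha f g h) u 0 i) z.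
Proof.
move=> dg; apply: differentiable_row_mx => [i|].
  exact: differentiable_comp_lsubmx.
apply: differentiable_row_mx => [i|].
  under eq_fun do rewrite mxE.
  apply: differentiableB; first exact: differentiable_cst.
  by apply: differentiable_dot => j; exact: differentiable_rsubmx_coord.
apply: differentiable_row_mx => i.
  under eq_fun do rewrite mxE.
  by apply: differentiableN; exact: differentiable_rsubmx_coord.
under eq_fun do rewrite mxE.
apply: differentiableD; first exact: differentiable_rsubmx_coord.
by under eq_fun do rewrite mxE.
Qed.

Lemma differentiable_RP_eqc (R : realType) n m p alpha (f : 'rV[R]_n -> R)
    (g : 'rV[R]_n -> 'rV[R]_m) (h : 'rV[R]_n -> 'rV[R]_p) z :
  (forall x, differentiable h x) ->
  forall i, differentiable (fun u => eqc (RP alpha f g h) u 0 i) z.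
Proof.
move=> dh; apply: differentiable_row_mx => i.
  exact: differentiable_comp_lsubmx.
under eq_fun do rewrite mxE.
apply: differentiableM.
  exact: differentiable_lsubmx_coord.
under eq_fun do rewrite mxE.
by apply: differentiableN; exact: differentiable_rsubmx_coord.
Qed.

(** The equality is exact at every iterate. In the new multipliers [x] and [y] are frozen at their
    values at [z], so they are not differentiated. *)
Lemma grad_LagRP (R : realType) n m p alpha (f : 'rV[R]_n -> R)
    (g : 'rV[R]_n -> 'rV[R]_m) (h : 'rV[R]_n -> 'rV[R]_p)
    (la : 'rV[R]_(m + (1 + (n + n)))) (lb : 'rV[R]_(p + n)) z :
  (forall x, differentiable f x) -> (forall x, differentiable g x) ->
  (forall x, differentiable h x) ->
  let Q := RP alpha f g h in
  let x := lsubmx z in let y := rsubmx z in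
  let kappa := rsubmx lb in
  grad (fun u => LagRP alpha f g h (lsubmx u) (rsubmx u)
      (lsubmx la) (lsubmx lb) (lsubmx (rsubmx la) 0 0)
      (hadamard kappa (Hmap y))
      (lsubmx (rsubmx (rsubmx la)) + hadamard kappa x)
      (rsubmx (rsubmx (rsubmx la)))) z =
  grad (objective Q) z
  + \sum_(i < m + (1 + (n + n))) la 0 i *: grad (fun u => ineq Q u 0 i) z
  + \sum_(j < p + n) lb 0 j *: grad (fun u => eqc Q u 0 j) z.
Proof.
move=> df dg dh Q x y kappa.
have dQf : differentiable (objective Q) z.
  apply: (@differentiable_comp _ _ _ _ (lsubmx : 'rV[R]_(n + n) -> _) f) => //.
  exact: differentiable_lsubmx.
have dQa := @differentiable_RP_ineq R n m p alpha f g h z dg.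
have dQb := @differentiable_RP_eqc R n m p alpha f g h z dh.
have dA := differentiable_dot la dQa.
have dB := differentiable_dot lb dQb.
have dFA := differentiableD dQf dA.
rewrite -!grad_dot// -!gradD//.
pose X i (u : 'rV[R]_(n + n)) := lsubmx u 0 i - x 0 i.
pose Y i (u : 'rV[R]_(n + n)) := rsubmx u 0 i - y 0 i.
have dX i : differentiable (X i) z.
  by apply: differentiableB => //; exact: differentiable_lsubmx_coord.
have dY i : differentiable (Y i) z.
  by apply: differentiableB => //; exact: differentiable_rsubmx_coord.
pose W u : 'rV[R]_n := \row_i (X i u * Y i u).
have dW i : differentiable (fun u => W u 0 i) z.
  by under eq_fun do rewrite mxE; exact: differentiableM.
(* Cancels the constant term of [dot kappa (W u)]. *)
pose c := - dot kappa (hadamard x y).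
have gradW : grad (fun u => dot kappa (W u)) z = 0.
  rewrite grad_dot//; apply: big1 => i _; under eq_fun do rewrite mxE.
  by rewrite grad_mul0 ?scaler0// /X /Y subrr.
have gradc : grad (cst c : 'rV[R]_(n + n) -> R) z = 0.
  by apply/rowP => j; rewrite !mxE derive_cst.
set E := (F in _ = grad F z).
have dE : differentiable E z by exact: differentiableD.
have dWk := differentiable_dot kappa dW.
have dEW := differentiableD dE dWk.
(* Adding two terms of zero gradient to [E] reduces the goal to an equality of functions. *)
rewrite -[RHS](_ : grad (E + (fun u => dot kappa (W u)) + cst c) z = _);
  last by rewrite gradD// gradD// gradW gradc !addr0.
congr (grad _ z); apply/funext => u.
rewrite /E /LagRP /Lag /cst !fctE /= !dot_row_mx.
have -> : dot (lsubmx (rsubmx la)) (const_mx (theta alpha (rsubmx u))) =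
    lsubmx (rsubmx la) 0 0 * theta alpha (rsubmx u).
  by rewrite /dot big_ord1 [const_mx _ _ _]mxE.
(* The only blocks in which the two Lagrangians differ; the identity is the expansion of
   [(x_i - x_i^k) (y_i - y_i^k)] in each coordinate. *)
have : dot (hadamard kappa (Hmap y)) (Gmap (lsubmx u)) +
    dot (lsubmx (rsubmx (rsubmx la)) + hadamard kappa x) (Hmap (rsubmx u)) =
    dot (lsubmx (rsubmx (rsubmx la))) (Hmap (rsubmx u)) +
    dot kappa (hadamard (Gmap (lsubmx u)) (Hmap (rsubmx u))) +
    dot kappa (W u) + c.
  rewrite /c /dot -sumrN -!big_split /=; apply: eq_bigr => i _.
  rewrite /W /X /Y /hadamard /Gmap /Hmap.
  by rewrite !mxE; ring.
rewrite -/kappa; lra.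
Qed.

End RelaxedProblem.

(** * Verification of the stationarity conditions *)

Theorem theorem4p3 (R : realType) (n m p alpha : nat)
  (halpha : 0 < alpha < n)
  (f : 'rV[R]_n -> R) (g : 'rV[R]_n -> 'rV[R]_m) (h : 'rV[R]_n -> 'rV[R]_p)
  (hf : C1 f) (hg : C1v g) (hh : C1v h) (xbar ybar : 'rV[R]_n) :
  CAKKT (RP alpha f g h) (row_mx xbar ybar) ->
  AW_stationary alpha f g h xbar ybar.
Proof.
have [[df _] [dg _] [dh _]] := And3 hf hg hh.
move=> [feas [z [la [lb [la0 zz gradz cs_a cs_b]]]]]; split => //.
pose x k := lsubmx (z k); pose y k := rsubmx (z k).
exists x, y, (fun k => lsubmx (la k)), (fun k => lsubmx (lb k)),
  (fun k => lsubmx (rsubmx (la k)) ord0 ord0),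
  (fun k => hadamard (rsubmx (lb k)) (Hmap (y k))),
  (fun k => lsubmx (rsubmx (rsubmx (la k))) + hadamard (rsubmx (lb k)) (x k))%R,
  (fun k => rsubmx (rsubmx (rsubmx (la k)))).
have min_a i := CAKKT_min
  (@differentiable_RP_ineq R n m p alpha f g h (row_mx xbar ybar) dg i)
  (feas.1 i) la0 zz cs_a.
split.
  by move=> k; split=> [i||i]; rewrite !mxE; exact: la0.
split.
- by apply: eq_fun_cvg zz => k; rewrite hsubmxK.
- by apply: eq_fun_cvg gradz => k; rewrite hsubmxK grad_LagRP.
- apply: cvg_mx_coord => i j; rewrite ord1 [(0 : 'rV__)%R _ _]mxE.
  by apply: eq_fun_cvg (min_a (lshift _ j)) => k; rewrite row_mxEl !mxE.
- apply: eq_fun_cvg (min_a (rshift _ (lshift _ ord0))) => k.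
  by rewrite row_mxEr row_mxEl !mxE.
(* The constraint is [x_i * (- y_i) = 0], hence the change of sign through [cvgN]. *)
have compl i : (rsubmx (lb k) 0 i * (x k 0 i * y k 0 i)
    @[k --> \oo] --> (0 : R))%R%classic.
  have := cvg_coord (FF := eventually_filter) (i := 0%R) (j := rshift p i) cs_b.
  rewrite mxE => /cvgN; rewrite oppr0; apply: eq_fun_cvg => k.
  by rewrite !fctE [LHS]/= [hadamard _ _ _ _]mxE row_mxEr !mxE; ring.
have xx i : (x k 0 i @[k --> \oo] --> xbar 0 i)%R%classic.
  have := cvg_coord (FF := eventually_filter) (i := 0%R) (j := lshift n i) zz.
  rewrite row_mxEl.
  by apply: eq_fun_cvg => k; rewrite mxE.
have yy i : (y k 0 i @[k --> \oo] --> ybar 0 i)%R%classic.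
  have := cvg_coord (FF := eventually_filter) (i := 0%R) (j := rshift n i) zz.
  rewrite row_mxEr.
  by apply: eq_fun_cvg => k; rewrite mxE.
have ybar0 i : (0 <= ybar 0 i)%R.
  have := feas.1 (rshift _ (rshift _ (lshift _ i))).
  by rewrite /= !row_mxEr row_mxEl row_mxKr mxE oppr_le0.
split.
(* Up to sign, [x_i] times its multiplier [kappa_i * H_i(y)] is the product in [compl]. *)
- move=> i; apply: cvg_min0 (normr_ge0 (xbar 0%R i)) _ _ _ => //.
  + by apply: cvg_norm; exact: xx.
  + have c0 : (`|rsubmx (lb k) 0 i * (x k 0 i * y k 0 i)|
        @[k --> \oo] --> `|0 : R|)%R%classic by apply: cvg_norm; exact: compl.
    rewrite normr0 in c0; apply: eq_fun_cvg c0 => k.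
    rewrite -normrM normr_id !mxE -normrN; congr (`|_|)%R.
    by rewrite /Gmap; ring.
- move=> i; apply: cvg_min0 (ybar0 i) _ _ _ => //.
  + by apply: eq_fun_cvg (yy i) => k; rewrite [Hmap _ _ _]mxE opprK.
  (* [j] is the index of [H_i] among all the inequalities. The product
     [y_i * (lambda^H_i + kappa_i * x_i)] is the difference of two products that vanish in the
     limit: the one in [compl] and [lambda^H_i * H_i(y)]. *)
  + pose j := rshift m (rshift 1 (lshift n i)).
    have H0 := cvg_coord (FF := eventually_filter) (i := 0%R) (j := j) cs_a.
    rewrite mxE in H0.
    have c0 : (`|rsubmx (lb k) 0 i * (x k 0 i * y k 0 i) -
        hadamard (la k) (ineq (RP alpha f g h) (z k)) 0 j|
        @[k --> \oo] --> `|0 - 0 : R|)%R%classic.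
      by apply: cvg_norm; apply: cvgB H0; exact: compl.
    rewrite subr0 normr0 in c0; apply: eq_fun_cvg c0 => k.
    rewrite [RHS]normrM normr_id -normrM; congr (`|_|)%R.
    by rewrite [hadamard (la k) _ _ _]mxE !row_mxEr row_mxEl !mxE; ring.
- apply: cvg_mx_coord => i j; rewrite ord1 [(0 : 'rV__)%R _ _]mxE.
  apply: eq_fun_cvg (min_a (rshift _ (rshift _ (rshift _ j)))) => k.
  by rewrite !row_mxEr !mxE.
Qed.
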